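(* Let $n\ge3$ be an integer, $\kappa\ge0$ real, and set, for $y\in(0,1)$, $$\Psi_0(y)=\begin{pmatrix}\sqrt y&1\\ \sqrt y&\frac{y(n-1)-1}{n-2}\end{pmatrix},\qquad T^{(\kappa)}=\begin{pmatrix}1&0\\0&\frac{2(n-2)}{\kappa+2}\end{pmatrix},$$ $$W^{(\kappa)}(y)=y^{\kappa+1}(1-y)^{\kappa+2n-3}\,\Psi_0(y)\,T^{(\kappa)}\,\Psi_0(y)^*,$$ $$D^{(\kappa)}=y(1-y)\partial_y^2+\partial_y\big(C+\kappa-y(U+2\kappa)\big)-\big(V+\kappa U+\kappa(\kappa-1)\big),$$ with $$C=\begin{pmatrix}\frac{2n-1}{n-1}&\frac{n-2}{n-1}\\ \frac1{n-1}&\frac{3n-4}{n-1}\end{pmatrix},\quad U=\begin{pmatrix}2n+1&0\\-1&2n+2\end{pmatrix},\quad V=\begin{pmatrix}0&0\\0&2n-2\end{pmatrix}.$$ Then $(W^{(\kappa)},D^{(\kappa)})$ is a matrix-valued classical pair on $(0,1)$, and if $(P_d^{(\kappa)})_{d\ge0}$ is a sequence of matrix-valued orthogonal polynomials with respect to $W^{(\kappa)}$, then the sequence of derivatives $(\partial_yP_d^{(\kappa)})_{d\ge1}$ is orthogonal with respect to $W^{(\kappa+1)}$.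
   Context: Scalars in matrix expressions stand for multiples of the identity; $^*$ is conjugate transpose. Differential operators act from the right: for $D=\partial_y^2F_2+\partial_yF_1+F_0$, $PD=P''F_2+P'F_1+PF_0$. A matrix-valued classical pair on $(0,1)$ is a pair $(W,D)$ where $W:(0,1)\to\mathbb C^{N\times N}$ is smooth, positive definite, with finite moments, and $D=\partial_y^2F_2+\partial_yF_1+F_0$ with $F_j$ a matrix polynomial of degree at most $j$, such that $\langle PD,Q\rangle_W=\langle P,QD\rangle_W$ for all matrix polynomials $P,Q$, where $\langle P,Q\rangle_W=\int_0^1P(y)W(y)Q(y)^*dy$. A sequence of matrix-valued orthogonal polynomials with respect to $W$ is a sequence $(P_d)_{d\ge0}$ of matrix polynomials with $\deg P_d=d$, invertible leading coefficients, and $\langle P_d,P_{d'}\rangle_W=0$ for $d\neq d'$. *)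

(* Defs.v *)
(* MathComp and MathComp-Analysis. Complex numbers are R[i], for a realType R. *)
From HB Require Import structures.
From mathcomp Require Import all_boot all_order all_algebra.
From mathcomp Require Import complex.
From mathcomp Require Import all_classical all_reals all_analysis.
Set Implicit Arguments.
Unset Strict Implicit.
Unset Printing Implicit Defensive.
Import Order.TTheory GRing.Theory Num.Theory.
Import numFieldNormedType.Exports.

Local Open Scope classical_set_scope.
Local Open Scope ring_scope.
Local Open Scope complex_scope.
Local Open Scope sesquilinear_scope.

(* N x N matrices are 'M[R[i]]_m.+1 with N = m.+1, so that they form a
   nontrivial ring and matrix polynomials are {poly 'M[R[i]]_m.+1}, with
   'X commuting with the matrix coefficients. *)
Section MatrixValuedClassicalPairs.
Variables (R : realType) (m : nat).
Local Notation C := R[i].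
Local Notation M := 'M[C]_m.+1.

Definition evalmx (P : {poly M}) (y : R) : M := P.[(y%:C)%:M].

Definition integralC01 (f : R -> C) : C :=
  Rintegral lebesgue_measure `]0, 1[ (fun y => complex.Re (f y))
  +i* Rintegral lebesgue_measure `]0, 1[ (fun y => complex.Im (f y)).

Definition integrableC01 (f : R -> C) : Prop :=
  lebesgue_measure.-integrable `]0, 1[ (fun y => (complex.Re (f y))%:E) /\
  lebesgue_measure.-integrable `]0, 1[ (fun y => (complex.Im (f y))%:E).

Definition inner (W : R -> M) (P Q : {poly M}) : M :=
  \matrix_(i, j)
    integralC01 (fun y => (evalmx P y *m W y *m (evalmx Q y) ^t*) i j).

Definition smooth01 (f : R -> R) : Prop :=
  forall (k : nat) (y : R), 0 < y < 1 -> derivable (derive1n k f) y 1.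

Definition smoothmx01 (W : R -> M) : Prop :=
  forall i j, smooth01 (fun y => complex.Re (W y i j)) /\
              smooth01 (fun y => complex.Im (W y i j)).

(* On R[i], 0 < z means that z is real and positive. *)
Definition posdefmx (A : M) : Prop :=
  A ^t* = A /\ forall v : 'rV[C]_m.+1, v != 0 -> 0 < (v *m A *m v ^t*) 0 0.

Definition finite_moments (W : R -> M) : Prop :=
  forall (k : nat) i j, integrableC01 (fun y => (y ^+ k)%:C * W y i j).

Definition is_weight (W : R -> M) : Prop :=
  [/\ smoothmx01 W,
      forall y : R, 0 < y < 1 -> posdefmx (W y) &
      finite_moments W].

Record diffop2 := DiffOp2 {
  opF2 : {poly M};
  opF1 : {poly M};
  opF0 : {poly M} }.

(* Coefficients multiply on the right. *)
Definition diffop2_act (P : {poly M}) (D : diffop2) : {poly M} :=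
  P^`(2) * opF2 D + P^`() * opF1 D + P * opF0 D.

(* The degree of P is (size P).-1. *)
Definition classical_pair (W : R -> M) (D : diffop2) : Prop :=
  [/\ is_weight W,
      [/\ (size (opF2 D) <= 3)%N, (size (opF1 D) <= 2)%N &
          (size (opF0 D) <= 1)%N] &
      forall P Q : {poly M},
        inner W (diffop2_act P D) Q = inner W P (diffop2_act Q D)].

Definition mvop (W : R -> M) (P : nat -> {poly M}) : Prop :=
  [/\ forall d : nat, size (P d) = d.+1,
      forall d : nat, lead_coef (P d) \in unitmx &
      forall d e : nat, d <> e -> inner W (P d) (P e) = 0].

End MatrixValuedClassicalPairs.

Section KappaFamily.
Variables (R : realType) (n : nat) (kappa : R).
Local Notation C := R[i].
Local Notation nC := (n%:R : C).

Definition mx22 (T : nzRingType) (a b c d : T) : 'M[T]_2 :=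
  \matrix_(i, j) nth 0 (nth [::] [:: [:: a; b]; [:: c; d]] i) j.

Definition Psi0 (y : R) : 'M[C]_2 :=
  mx22 (Num.sqrt y)%:C 1
       (Num.sqrt y)%:C ((y * (n%:R - 1) - 1) / (n%:R - 2))%:C.

Definition Tmx : 'M[C]_2 :=
  mx22 1 0
       0 (2 * (n%:R - 2) / (kappa + 2))%:C.

Definition Wkappa (y : R) : 'M[C]_2 :=
  (y `^ (kappa + 1) * (1 - y) `^ (kappa + 2 * n%:R - 3))%:C *:
    (Psi0 y *m Tmx *m (Psi0 y) ^t*).

Definition Cmx : 'M[C]_2 :=
  mx22 ((2 * nC - 1) / (nC - 1)) ((nC - 2) / (nC - 1))
       (1 / (nC - 1))            ((3 * nC - 4) / (nC - 1)).

Definition Umx : 'M[C]_2 :=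
  mx22 (2 * nC + 1) 0
       (- 1)        (2 * nC + 2).

Definition Vmx : 'M[C]_2 :=
  mx22 0 0
       0 (2 * nC - 2).

Definition Dkappa : diffop2 R 1 :=
  let k : C := kappa%:C in
  @DiffOp2 R 1
    ('X * (1 - 'X))
    ((Cmx + k%:M)%:P - 'X * (Umx + (2 * k)%:M)%:P)
    (- (Vmx + k *: Umx + (k * (k - 1))%:M)%:P).

End KappaFamily.

(* Main.v *)
(* On (0, 1), W_kappa = w S with w = y^(kappa+1) (1-y)^(kappa+2n-3) and S a
   matrix polynomial, so inner products are values of the moment functional
   L F = int w F. As w sigma vanishes at both ends for sigma = y(1-y), and
   (w sigma)' = w rho with rho = kappa+2 - (2 kappa+2n) y, integration by
   parts reads L (rho F + sigma F') = 0. Symmetry of D_kappa then follows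
   from algebraic identities between S and the coefficients of D_kappa.
   For the derivatives, w_(kappa+1) = w sigma and there are matrix polynomials
   Phi (degree 2) and Psi (degree 1) with sigma S_(kappa+1) = S Phi and
   rho S_(kappa+1) + sigma S_(kappa+1)' = S Psi; integrating by parts, the
   inner product of P' and Q for W_(kappa+1) is minus that of P and R for
   W_kappa, where R^* = Psi Q^* + Phi Q^*' has degree at most deg Q + 1. *)
From HB Require Import structures.
Require Import Defs.
From mathcomp Require Import all_boot all_order all_algebra.
From mathcomp Require Import complex.
From mathcomp Require Import all_classical all_reals all_analysis.
From mathcomp Require Import ring lra zify.
Set Implicit Arguments.
Unset Strict Implicit.
Unset Printing Implicit Defensive.
Import Order.TTheory GRing.Theory Num.Theory.
Import numFieldNormedType.Exports.
Local Open Scope ring_scope.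
Local Open Scope complex_scope.
Local Open Scope sesquilinear_scope.

(** * Matrix polynomials: adjoints, values at real points, moment functionals *)

Section MatrixPolynomials.
Variables (R : realType) (m : nat).
Local Notation C := R[i].
Local Notation M := 'M[C]_m.+1.
Implicit Types (A B : M) (P Q F : {poly M}) (a b : C) (mu : nat -> C).

Lemma adjmxM A B : (A * B) ^t* = B ^t* * A ^t*.
Proof. by rewrite -mulmxE trmx_mul map_mxM. Qed.

Lemma adjmxD A B : (A + B) ^t* = A ^t* + B ^t*.
Proof. by rewrite !raddfD. Qed.

Lemma adjmx_sum (I : Type) (r : seq I) (E : I -> M) :
  (\sum_(i <- r) E i) ^t* = \sum_(i <- r) (E i) ^t*.
Proof. by rewrite !raddf_sum. Qed.

Lemma adjmx_scale_real (c : R) A : (c%:C *: A) ^t* = c%:C *: A ^t*.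
Proof.
apply/matrixP => i j; rewrite !mxE rmorphM /=; congr (_ * _).
by rewrite conj_Creal // complex_real.
Qed.

(** The variable is treated as self-adjoint, so that at a real point the value of [adjp P] is the
    conjugate transpose of the value of [P]. *)
Definition adjp P : {poly M} := \poly_(i < size P) (P`_i) ^t*.

Lemma coef_adjp P i : (adjp P)`_i = (P`_i) ^t*.
Proof.
rewrite coef_poly; case: ltnP => // /(nth_default 0) ->.
by rewrite trmx0 map_mx0.
Qed.

Lemma size_adjp P : (size (adjp P) <= size P)%N.
Proof. exact: size_poly. Qed.

Lemma adjpK P : adjp (adjp P) = P.
Proof. by apply/polyP => i; rewrite !coef_adjp trmxCK. Qed.

Lemma adjpM P Q : adjp (P * Q) = adjp Q * adjp P.
Proof.
apply/polyP => i; rewrite coef_adjp coefM coefMr adjmx_sum.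
by apply: eq_bigr => j _; rewrite !coef_adjp adjmxM.
Qed.

Lemma adjpD P Q : adjp (P + Q) = adjp P + adjp Q.
Proof. by apply/polyP => i; rewrite coefD !coef_adjp coefD adjmxD. Qed.

Lemma adjpN P : adjp (- P) = - adjp P.
Proof. by apply/polyP => i; rewrite coefN !coef_adjp coefN !raddfN. Qed.

Lemma adjp0 : adjp 0 = 0.
Proof. by apply/polyP => i; rewrite coef_adjp coef0 trmx0 map_mx0. Qed.

Lemma adjp_deriv P : adjp P^`() = (adjp P)^`().
Proof. by apply/polyP => i; rewrite !(coef_adjp, coef_deriv) !raddfMn. Qed.

Lemma adjp_C A : adjp A%:P = (A ^t*)%:P.
Proof.
apply/polyP => i; rewrite coef_adjp !coefC.
by case: eqP => // _; rewrite trmx0 map_mx0.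
Qed.

Lemma adjp_X : adjp 'X = 'X.
Proof.
apply/polyP => i; rewrite coef_adjp !coefX.
by case: eqP => // _; rewrite ?trmx0 ?map_mx0 // trmx1 map_mx1.
Qed.

(** Evaluation over a noncommutative ring is multiplicative here because the point is a scalar
    matrix, hence central. *)
Lemma evalmxM P Q (y : R) : evalmx (P * Q) y = evalmx P y * evalmx Q y.
Proof. by rewrite /evalmx hornerM_comm // /comm_poly -!mulmxE scalar_mxC. Qed.

Lemma evalmxD P Q (y : R) : evalmx (P + Q) y = evalmx P y + evalmx Q y.
Proof. exact: hornerD. Qed.

Lemma evalmxN P (y : R) : evalmx (- P) y = - evalmx P y.
Proof. exact: hornerN. Qed.

Lemma evalmxC A (y : R) : evalmx A%:P y = A.
Proof. exact: hornerC. Qed.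

Lemma evalmxX (y : R) : evalmx 'X y = (y%:C)%:M :> M.
Proof. exact: hornerX. Qed.

Lemma evalmxE P (y : R) : evalmx P y = \sum_(i < size P) (y%:C ^+ i) *: P`_i.
Proof.
rewrite /evalmx horner_coef; apply: eq_bigr => i _.
by rewrite -(rmorphXn (@scalar_mx C m.+1)) -mulmxE mul_mx_scalar.
Qed.

Lemma evalmx_adjp P (y : R) : evalmx (adjp P) y = (evalmx P y) ^t*.
Proof.
rewrite [LHS]/evalmx (horner_coef_wide _ (size_adjp P)) evalmxE adjmx_sum.
apply: eq_bigr => i _; rewrite coef_adjp.
rewrite -(rmorphXn (@scalar_mx C m.+1)) -mulmxE mul_mx_scalar.
rewrite linearZ map_mxZ rmorphXn /=; congr (_ ^+ _ *: _).
by rewrite conj_Creal // complex_real.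
Qed.

(** Each entry of [P - Q] is a complex polynomial with infinitely many real roots. Polynomial
    identities may thus be checked at real points. *)
Lemma evalmx_inj P Q : (forall y : R, evalmx P y = evalmx Q y) -> P = Q.
Proof.
move=> PQ; apply/eqP; rewrite -subr_eq0; apply/eqP.
set D := P - Q; apply/polyP => k; rewrite coef0.
apply/matrixP => i j; rewrite [RHS]mxE.
pose d : {poly C} := \poly_(l < size D) D`_l i j.
have dE l : d`_l = D`_l i j.
  by rewrite coef_poly; case: ltnP => // /(nth_default 0) ->; rewrite mxE.
have d0 (y : R) : d.[y%:C] = 0.
  rewrite horner_poly.
  have: evalmx D y i j = 0 by rewrite evalmxD evalmxN PQ subrr mxE.
  rewrite evalmxE summxE => {2}<-; apply: eq_bigr => l _.
  by rewrite mxE mulrC.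
suff d_eq0 : d = 0 by rewrite -dE d_eq0 coef0.
apply/eqP; apply: contraT => dn0.
(* The naturals below [size d] are distinct roots of [d], one more than its degree allows. *)
pose s := [seq (l%:R : R)%:C | l <- iota 0 (size d)].
have := max_poly_roots dn0 (rs := s).
rewrite size_map size_iota ltnn => -> //.
  by apply/allP => x /mapP[l _ ->]; rewrite rootE d0.
rewrite map_inj_uniq ?iota_uniq // => k1 k2 [] /eqP.
by rewrite eqr_nat => /eqP.
Qed.

(** If [mu k] is the k-th moment of a scalar weight w, this is the integral of w F; all analysis is
    then carried by [mu]. *)
Definition moment_functional mu F : M := \sum_(i < size F) mu i *: F`_i.

Lemma moment_functional_wide mu F n : (size F <= n)%N ->
  moment_functional mu F = \sum_(i < n) mu i *: F`_i.
Proof.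
move=> Fn; rewrite /moment_functional (big_ord_widen n (fun i => mu i *: F`_i)) //.
rewrite big_mkcond; apply: eq_bigr => i _.
by case: ltnP => // /(nth_default 0) ->; rewrite scaler0.
Qed.

Lemma moment_functional_is_additive mu : additive (moment_functional mu).
Proof.
move=> F G; pose n := maxn (size F) (size G).
rewrite !(@moment_functional_wide mu _ n) ?leq_maxl ?leq_maxr //.
  by rewrite -sumrB; apply: eq_bigr => i _; rewrite coefB scalerBr.
by rewrite (leq_trans (size_polyD _ _)) // size_polyN.
Qed.

HB.instance Definition _ mu := GRing.isZmodMorphism.Build _ _
  (moment_functional mu) (@moment_functional_is_additive mu).

Lemma moment_functional_Cl mu A F :
  moment_functional mu (A%:P * F) = A * moment_functional mu F.
Proof.
rewrite (@moment_functional_wide mu (A%:P * F) (size F)); last first.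
  by rewrite mul_polyC size_scale_leq.
rewrite mulr_sumr; apply: eq_bigr => i _.
by rewrite coefCM scalerAr.
Qed.

Lemma moment_functional_Cr mu A F :
  moment_functional mu (F * A%:P) = moment_functional mu F * A.
Proof.
rewrite (@moment_functional_wide mu (F * A%:P) (size F)); last first.
  apply/leq_sizeP => j /(nth_default 0) Fj0.
  by rewrite coefMC Fj0 mul0r.
rewrite mulr_suml; apply: eq_bigr => i _.
by rewrite coefMC scalerAl.
Qed.

Lemma moment_functional_adjp mu F : (forall k, mu k \is Num.real) ->
  moment_functional mu (adjp F) = (moment_functional mu F) ^t*.
Proof.
move=> mu_real; rewrite (moment_functional_wide _ (size_adjp F)) adjmx_sum.
by apply: eq_bigr => i _; rewrite coef_adjp linearZ map_mxZ /= conj_Creal.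
Qed.

Lemma moment_functional_monomial mu A k :
  moment_functional mu (A%:P * 'X^k) = mu k *: A.
Proof.
rewrite moment_functional_Cl /moment_functional size_polyXn big_ord_recr /=.
rewrite big1 ?add0r => [|i _].
  by rewrite coefXn eqxx -scalerAr mulr1.
by rewrite coefXn ltn_eqF // scaler0.
Qed.

Lemma monomial_sum F : F = \sum_(k < size F) (F`_k)%:P * 'X^k.
Proof.
by rewrite -[LHS]coefK poly_def; apply: eq_bigr => k _; rewrite mul_polyC.
Qed.

End MatrixPolynomials.

(** * Integration by parts, symmetry and orthogonality for moment functionals *)

Section PearsonPairs.
Variables (R : realType) (m : nat) (mu : nat -> R[i]).
Local Notation C := R[i].
Local Notation M := 'M[C]_m.+1.
Local Notation L := (@moment_functional R m mu).
Implicit Types (P Q F S H : {poly M}) (a b : C).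

Definition pearson_rho a b : {poly M} := a%:M%:P - b%:M%:P * 'X.
Definition pearson_sigma : {poly M} := 'X * (1 - 'X).
Local Notation sigma := pearson_sigma.

Lemma pearson_rhoC a b F : F * pearson_rho a b = pearson_rho a b * F.
Proof.
have sC c : F * (c%:M)%:P = (c%:M)%:P * F.
  by apply/polyP => i; rewrite coefMC coefCM -!mulmxE scalar_mxC.
by rewrite mulrBr mulrBl sC mulrA sC -!mulrA commr_polyX.
Qed.

Lemma pearson_sigmaC F : F * sigma = sigma * F.
Proof.
rewrite /sigma mulrBr mulr1 !(mulrBr, mulrBl) !mulrA commr_polyX.
by rewrite -[RHS]/('X * F - 'X * 'X * F) -!mulrA commr_polyX.
Qed.

(** By linearity F = A X^k suffices, where rho F + sigma F' = (a + k) A X^k - (b + k) A X^(k+1); the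
    functional kills this by the recurrence. *)
Lemma moment_functional_pearson a b :
  (forall k, (a + k%:R) * mu k = (b + k%:R) * mu k.+1) ->
  forall F, L (pearson_rho a b * F) + L (sigma * F^`()) = 0.
Proof.
move=> rec F; rewrite -raddfD (monomial_sum F) /= raddf_sum /=.
rewrite !mulr_sumr -big_split raddf_sum big1 //= => k _.
have rhoE (A : M) : pearson_rho a b * (A%:P * 'X^k) =
    (a *: A)%:P * 'X^k - (b *: A)%:P * 'X^(k.+1).
  rewrite /pearson_rho mulrBl -!mulrA -(commr_polyX (_ * _)) -!mulrA -exprSr.
  by rewrite !mulrA -!polyCM -!mulmxE !mul_scalar_mx.
have sigmaE (A : M) : sigma * (A%:P * 'X^k)^`() =
    (k%:R *: A)%:P * 'X^k - (k%:R *: A)%:P * 'X^(k.+1).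
  rewrite -pearson_sigmaC mul_polyC derivZ derivXn -!mul_polyC.
  rewrite !scaler_nat !polyCMn /sigma mulrBr mulr1 mulrBr.
  (* The case k = 0 is apart because the exponent of the derivative is the truncated predecessor of
     k. *)
  case: (nat_of_ord k) => [|l]; first by rewrite !mulr0n mulr0 !mul0r subr0.
  by rewrite !(mulrnAr, mulrnAl) -!mulrA -!exprSr /= (mulrA 'X^_) -!exprSr.
rewrite rhoE sigmaE raddfD !raddfB /= !moment_functional_monomial !scalerA.
rewrite addrACA -opprD -!scalerDl -!mulrDr.
by apply/eqP; rewrite subr_eq0 mulrC rec mulrC.
Qed.

Definition moment_form S P Q := L (P * S * adjp Q).

(* The defect [H] between [F1 S] and [rho S + sigma S'] cancels after
   one more integration by parts, applied to [P H Q^*]. *)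
Lemma moment_form_symmetric a b S H F1 F0 P Q :
  (forall k, (a + k%:R) * mu k = (b + k%:R) * mu k.+1) ->
  F1 * S = pearson_rho a b * S + sigma * S^`() - sigma * H ->
  S * adjp F1 = pearson_rho a b * S + sigma * S^`() + sigma * H ->
  pearson_rho a b * H + sigma * H^`() = S * adjp F0 - F0 * S ->
  moment_form S (diffop2_act P (DiffOp2 sigma F1 F0)) Q =
  moment_form S P (diffop2_act Q (DiffOp2 sigma F1 F0)).
Proof.
move=> /moment_functional_pearson pearson F1S SF1 HF0.
have adj_sigma : adjp sigma = sigma.
  rewrite /sigma adjpM adjpD adjpN adjp_X -polyC1 adjp_C trmx1 map_mx1.
  exact: commr_polyX.
have sC := pearson_sigmaC; have rC := @pearson_rhoC a b.
(* Here rho, and just below sigma, become variables known only through centrality, the Pearson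
   identity and the hypotheses on S and H; for sigma also self-adjointness. *)
move: (pearson_rho a b) rC pearson F1S SF1 HF0 => rho rC pearson F1S SF1 HF0.
rewrite /moment_form /diffop2_act /=.
move: sigma sC adj_sigma pearson F1S SF1 HF0 => s sC adj_s pearson F1S SF1 HF0.
rewrite !adjpD !adjpM adj_s !adjp_deriv /derivn /=.
move: (adjp Q) (adjp F1) SF1 (adjp F0) HF0 => q f1 SF1 f0 HF0.
(* The first two integrations by parts absorb the terms with P'' and with Q''; both produce sigma P'
   S Q^*', which cancels. The third absorbs what H leaves behind. *)
have e1 := pearson (P^`() * S * q).
have e2 := pearson (P * S * q^`()).
have e3 := pearson (P * H * q).
have l1 : P^`() * F1 * S * q =
    rho * P^`() * S * q + s * P^`() * S^`() * q - s * P^`() * H * q.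
  by rewrite -!(mulrA _ F1) F1S mulrBr mulrDr !mulrA rC sC mulrBl mulrDl.
have l2 : P * S * (f1 * q^`()) =
    rho * P * S * q^`() + s * P * S^`() * q^`() + s * P * H * q^`().
  by rewrite mulrA -!(mulrA P S) SF1 !mulrDr !mulrA rC sC !mulrDl.
have l3 : rho * P * H * q + s * P * H^`() * q =
    P * S * (f0 * q) - P * F0 * S * q.
  rewrite -rC -sC mulrA -mulrDl -!(mulrA P) -mulrDr HF0.
  by rewrite mulrBr mulrBl !mulrA.
have l4 : P^`()^`() * s * S * q = s * P^`()^`() * S * q by rewrite sC.
have l5 : P * S * (s * q^`()^`()) = s * P * S * q^`()^`().
  by rewrite mulrA sC !mulrA.
rewrite !mulrDr !mulrDl l1 l2 l4 l5.
move: e1 e2 e3; rewrite !derivM !mulrDl !mulrDr !mulrA -!raddfD /=.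
move=> e1 e2 e3.
(* Left side minus right side is the functional at the integrand of [e1] minus those of [e2] and
   [e3]. *)
apply/eqP; rewrite -subr_eq0 -raddfB -[X in X == _]subr0.
rewrite -[X in _ - X]e1 -raddfB -[X in X == _]addr0.
rewrite -[X in _ + X]e2 -raddfD -[X in X == _]addr0 -[X in _ + X]e3 -raddfD.
have l6 : P * F0 * S * q =
    P * S * f0 * q - rho * P * H * q - s * P * H^`() * q.
  by apply/eqP; rewrite -addrA -opprD l3 mulrA opprB addrC subrK.
rewrite l6 -(raddf0 L); apply/eqP; congr (L _).
(* Noncommutative products stay whole: their coefficient entries are atoms of an additive identity
   in a commutative ring. *)
by apply/polyP => k; rewrite !(coefD, coefN); apply/matrixP => i j;
   rewrite !(coef0, mxE); ring.
Qed.

Lemma moment_form_sumr S P (I : Type) (r : seq I) (E : I -> {poly M}) :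
  moment_form S P (\sum_(i <- r) E i) = \sum_(i <- r) moment_form S P (E i).
Proof.
elim: r => [|i r IH]; last first.
  by rewrite !big_cons -IH /moment_form adjpD mulrDr raddfD.
by rewrite !big_nil /moment_form adjp0 mulr0 raddf0.
Qed.

Lemma moment_form_Cr S P A Q :
  moment_form S P (A%:P * Q) = moment_form S P Q * A ^t*.
Proof. by rewrite /moment_form adjpM adjp_C mulrA moment_functional_Cr. Qed.

Lemma moment_form_adj S P Q :
  (forall k, mu k \is Num.real) -> adjp S = S ->
  (moment_form S P Q) ^t* = moment_form S Q P.
Proof.
move=> mu_real S_herm; rewrite -moment_functional_adjp //.
by rewrite !adjpM adjpK S_herm mulrA.
Qed.

(** The algebraic counterpart of [mvop], with [moment_form] in place of the integral inner
    product. *)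
Definition moment_orthogonal S (P : nat -> {poly M}) :=
  [/\ forall d, size (P d) = d.+1, forall d, lead_coef (P d) \in unitmx
    & forall d e, d <> e -> moment_form S (P d) (P e) = 0].

(* Peels off the leading term of [Q] with a left multiple of [P k], which uses
   that the leading coefficients are invertible. *)
Lemma orthogonal_low_degree S (P : nat -> {poly M}) d Q :
  moment_orthogonal S P -> (size Q <= d)%N -> moment_form S (P d) Q = 0.
Proof.
move=> [szP lcP orthP].
suff low k (F : {poly M}) : (size F <= k)%N -> (k <= d)%N ->
    moment_form S (P d) F = 0 by move=> /(low _ _ (leqnn _)).
elim: k F => [|k IH] {}Q; last move=> Qk kd.
  rewrite leqn0 size_poly_eq0 => /eqP -> _.
  by have := moment_form_sumr S (P d) [::] (fun _ : nat => 0); rewrite !big_nil.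
pose A := Q`_k * invmx (lead_coef (P k)).
have Ak : A * (P k)`_k = Q`_k.
  have := lcP k; rewrite /lead_coef szP /= => u.
  by rewrite /A -mulrA /lead_coef szP /= -!mulmxE mulVmx // mulmx1.
have szQ' : (size (Q - A%:P * P k)%R <= k)%N.
  apply/leq_sizeP => j; rewrite leq_eqVlt => /predU1P[<-|kj].
    by rewrite coefB coefCM Ak subrr.
  rewrite coefB coefCM !nth_default ?mulr0 ?subrr ?szP //.
  exact: leq_trans Qk kj.
have := moment_form_sumr S (P d) [:: Q - A%:P * P k; A%:P * P k] id.
rewrite !big_cons !big_nil !addr0 /= subrK => ->.
rewrite IH ?(ltnW kd) // moment_form_Cr orthP ?mul0r ?addr0 //.
by move=> dk; rewrite dk ltnn in kd.
Qed.

End PearsonPairs.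

(** Pairing P' with Q for [mu1] and [S1] is minus pairing P with [Rd Q] for [mu] and [S]. For Q the
    derivative of [P e.+1] with e < d, [Rd Q] has degree at most e + 1 < d + 1, so [P d.+1] is
    orthogonal to it. *)
Lemma moment_orthogonal_deriv (R : realType) (m : nat) (mu mu1 : nat -> R[i])
    (a b : R[i]) (S S1 Phi Psi : {poly 'M[R[i]]_m.+1})
    (P : nat -> {poly 'M[R[i]]_m.+1}) :
  (forall k, (a + k%:R) * mu k = (b + k%:R) * mu k.+1) ->
  (forall k, mu1 k = mu k.+1 - mu k.+2) ->
  (forall k, mu1 k \is Num.real) -> adjp S1 = S1 ->
  pearson_sigma R m * S1 = S * Phi ->
  pearson_rho m a b * S1 + pearson_sigma R m * S1^`() = S * Psi ->
  (size Phi <= 3)%N -> (size Psi <= 2)%N ->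
  moment_orthogonal mu S P ->
  moment_orthogonal mu1 S1 (fun d => (P d.+1)^`()).
Proof.
move=> rec mu1E mu1_real S1_herm sS1 rS1 szPhi szPsi orthP.
have [szP lcP _] := orthP.
(* The hypothesis on [mu1] says that its weight is sigma times that of [mu], as sigma X^k = X^(k+1)
   - X^(k+2). *)
have L1 F : moment_functional mu1 F =
    moment_functional mu (pearson_sigma R m * F).
  rewrite /pearson_sigma (monomial_sum F) mulr_sumr !raddf_sum.
  apply: eq_bigr => k _; rewrite mulrBr mulr1 -expr2 mulrBl.
  rewrite -commr_polyX -(commr_polyXn _ 2) -!mulrA -exprSr -exprD raddfB /=.
  by rewrite !moment_functional_monomial addn2 -scalerBl mu1E.
pose Rd Q := adjp (Psi * adjp Q + Phi * adjp Q^`()).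
have formE P0 Q : moment_form mu1 S1 P0^`() Q = - moment_form mu S P0 (Rd Q).
  rewrite /moment_form L1 /Rd adjpK.
  (* Integrating P S1 Q^* by parts: the two factorizations through S turn every term without P' into
     P S times the adjoint of [Rd Q]. *)
  have := moment_functional_pearson rec (P0 * S1 * adjp Q).
  rewrite -raddfD /=; set X := (X in moment_functional mu X).
  have -> : X = pearson_sigma R m * (P0^`() * S1 * adjp Q) +
      P0 * S * (Psi * adjp Q + Phi * adjp Q^`()).
    have [sC rC] := (@pearson_sigmaC R m, @pearson_rhoC R m a b).
    rewrite /X => {X}; move: rS1 sS1 sC rC.
    move: (pearson_sigma R m) (pearson_rho m a b) => s r rS1 sS1 sC rC.
    rewrite mulrDr !mulrA -!(mulrA P0 S) -rS1 -sS1 !derivM adjp_deriv.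
    rewrite !mulrDr !mulrDl !mulrDr !mulrA !sC !rC.
    rewrite addrCA -!addrA; congr (_ + _).
    by rewrite addrCA.
  by rewrite raddfD /= => /eqP; rewrite addr_eq0 => /eqP.
(* [Psi] adds one degree; [Phi] adds two, but the derivative of Q has already lost one. *)
have szRd (Q : {poly 'M[R[i]]_m.+1}) d : (size Q <= d.+1)%N -> (size (Rd Q) <= d.+2)%N.
  move=> Qd; apply: leq_trans (size_adjp _) _.
  apply: leq_trans (size_polyD _ _) _; rewrite geq_max; apply/andP; split.
    apply: leq_trans (size_polyMleq _ _) _.
    by have := size_adjp Q; lia.
  apply: leq_trans (size_polyMleq _ _) _.
  have := size_adjp Q^`(); have : (size Q^`() <= d)%N.
    apply/leq_sizeP => j dj; rewrite coef_deriv nth_default ?mul0rn //.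
    exact: leq_trans Qd _.
  lia.
have lcD d : (P d.+1)^`()`_d \in unitmx.
  have := lcP d.+1; rewrite /lead_coef szP /= => u.
  by rewrite coef_deriv -scaler_nat unitmxZ // unitfE pnatr_eq0.
have szD d : size (P d.+1)^`() = d.+1.
  apply/eqP; rewrite eqn_leq; apply/andP; split.
    apply/leq_sizeP => j dj; rewrite coef_deriv nth_default ?mul0rn //.
    by rewrite szP.
  rewrite ltnNge; apply/negP => /(nth_default 0) D0.
  by have := lcD d; rewrite D0 unitmxE det0 unitr0.
have orth_lt d e : (e < d)%N ->
    moment_form mu1 S1 (P d.+1)^`() (P e.+1)^`() = 0.
  move=> ed; rewrite formE (orthogonal_low_degree orthP) ?oppr0 //.
  by apply: leq_trans (szRd _ e _) _; rewrite ?szD.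
split=> // [d|d e /eqP]; last first.
  (* The case d < e follows from the other by taking adjoints. *)
  rewrite neq_ltn => /orP[de|]; last exact: orth_lt.
  by rewrite -(moment_form_adj _ _ mu1_real S1_herm) orth_lt // trmx0 map_mx0.
by rewrite /lead_coef szD.
Qed.

(** * Scalar Jacobi weights on (0, 1): derivatives, integrability, moments *)

Section JacobiWeight.
Variable R : realType.
Implicit Types (a b y : R) (p q : {poly R}).

Definition jacobi a b p y : R := y `^ a * (1 - y) `^ b * p.[y].

(** The polynomial left when y^(a-1) (1-y)^(b-1) is factored out of the derivative of
    [jacobi a b p]. *)
Definition jacobi_deriv a b p : {poly R} :=
  (a%:P - (a + b)%:P * 'X) * p + 'X * (1 - 'X) * p^`().

Lemma is_derive_onem y : is_derive y 1 (fun x : R => 1 - x) (- 1).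
Proof.
have := is_deriveB (is_derive_cst (1 : R) y 1) (is_derive_id y 1).
by rewrite sub0r.
Qed.

Lemma is_derive_jacobi a b p y : 0 < y < 1 ->
  is_derive y 1 (jacobi a b p) (jacobi (a - 1) (b - 1) (jacobi_deriv a b p) y).
Proof.
move=> /andP[y0 y1].
have y1' : 0 < 1 - y by rewrite subr_gt0.
have dy := is_derive_onem y.
have d2 : is_derive y 1 ((fun x : R => x `^ b) \o (fun x : R => 1 - x))
    (b * (1 - y) `^ (b - 1) * - 1).
  by apply: is_derive1_comp; exact: is_derive1_powR.
have d1 := is_derive1_powR a y0.
have d3 := is_derive_poly p y.
apply: is_derive_eq.
rewrite /jacobi /jacobi_deriv /=.
have powRS (x c : R) : 0 < x -> x `^ c = x * x `^ (c - 1).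
  move=> x0; rewrite -[X in X * _](@powRr1 _ x) ?ltW // -powRD ?subrKC //.
  by rewrite (gt_eqF x0) implybT.
rewrite (powRS y a y0) (powRS _ b y1') !hornerE /= /GRing.scale /=.
ring.
Qed.

Lemma is_derive_continuous (f : R -> R) y d :
  is_derive y 1 f d -> {for y, continuous f}.
Proof. by move=> [df _]; exact/differentiable_continuous/derivable1_diffP. Qed.

Lemma cvg_at_right_jacobi a b p : 0 < a ->
  (jacobi a b p x @[x --> 0^'+] --> jacobi a b p 0)%classic.
Proof.
move=> a0; rewrite {2}/jacobi powR0 ?gt_eqF //.
apply: cvgM; last exact/cvg_at_right_filter/continuous_horner.
apply: cvgM; first exact: powR_cvg0.
apply: cvg_at_right_filter.
apply: (@is_derive_continuous (fun x : R => (1 - x) `^ b) 0).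
apply: (@is_derive1_comp _ (fun x : R => x `^ b) (fun x : R => 1 - x)).
  by apply: is_derive1_powR; rewrite subr0.
Qed.

Lemma cvg_at_left_jacobi a b p : 0 < b ->
  (jacobi a b p x @[x --> 1^'-] --> jacobi a b p 1)%classic.
Proof.
move=> b0; rewrite {2}/jacobi subrr powR0 ?gt_eqF //.
apply: cvgM; last exact/cvg_at_left_filter/continuous_horner.
apply: cvgM.
  apply: cvg_at_left_filter.
  apply: (@is_derive_continuous (fun x : R => x `^ a) 1).
  exact: is_derive1_powR.
(* The reflection x -> 1 - x carries the left limit at 1 to a right limit at 0. *)
apply: (@decreasing_cvg_at_left_comp _ (fun x : R => 1 - x) (fun x : R => x `^ b)
  -oo%O); rewrite //=.
- by move=> x y _ _; rewrite ltrD2l ltrN2.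
- apply: cvg_at_left_filter; apply: cvgB; [exact: cvg_cst|exact: cvg_id].
- by rewrite subrr; exact: powR_cvg0.
Qed.

Lemma continuous_jacobi a b p : 0 < a -> 0 < b ->
  {within `[0, 1], continuous (jacobi a b p)}%classic.
Proof.
move=> a0 b0; apply/(continuous_within_itvP _ ltr01); split.
- move=> y; rewrite in_itv /= => /(is_derive_jacobi a b p).
  exact: is_derive_continuous.
- exact: cvg_at_right_jacobi.
- exact: cvg_at_left_jacobi.
Qed.

(** Positive exponents make the function continuous on the compact interval [0, 1]. *)
Lemma integrable_jacobi a b p : 0 < a -> 0 < b ->
  (lebesgue_measure.-integrable `]0%R, 1%R[ (EFin \o jacobi a b p))%classic.
Proof.
move=> a0 b0; apply: (@integrableS _ _ R lebesgue_measure (`[0%R, 1%R]%classic : set R)) => //.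
  exact: subset_itv_oo_cc.
apply: continuous_compact_integrable; first exact: segment_compact.
exact: continuous_jacobi.
Qed.

Definition jacobi_integral a b p : R :=
  (\int[lebesgue_measure]_(y in `]0%R, 1%R[) jacobi a b p y)%R.

Lemma jacobi_integralD a b p q : 0 < a -> 0 < b ->
  jacobi_integral a b (p + q) = jacobi_integral a b p + jacobi_integral a b q.
Proof.
move=> a0 b0; rewrite /jacobi_integral -RintegralD //; try exact: integrable_jacobi.
by apply: eq_Rintegral => y _; rewrite /jacobi hornerD mulrDr.
Qed.

Lemma jacobi_integralZ a b c p : 0 < a -> 0 < b ->
  jacobi_integral a b (c *: p) = c * jacobi_integral a b p.
Proof.
move=> a0 b0; rewrite /jacobi_integral -RintegralZl //; last exact: integrable_jacobi.
by apply: eq_Rintegral => y _; rewrite /jacobi hornerZ mulrCA.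
Qed.

Definition jacobi_moment a b k : R := jacobi_integral a b 'X^k.

Lemma jacobi_integral_poly a b n (E : nat -> R) : 0 < a -> 0 < b ->
  jacobi_integral a b (\poly_(k < n) E k) = \sum_(k < n) jacobi_moment a b k * E k.
Proof.
move=> a0 b0; rewrite poly_def.
elim: n => [|n IH].
  by rewrite !big_ord0 -[0 in LHS](scale0r 0) jacobi_integralZ // mul0r.
by rewrite !big_ord_recr jacobi_integralD // IH jacobi_integralZ // mulrC.
Qed.

(** The integrand is the derivative of [jacobi (a + 1) (b + 1) p], which vanishes at 0 and at 1. *)
Lemma jacobi_integral_deriv a b p : 0 < a -> 0 < b ->
  jacobi_integral a b (jacobi_deriv (a + 1) (b + 1) p) = 0.
Proof.
move=> a0 b0; have [a1 b1] : 0 < a + 1 /\ 0 < b + 1 by split; apply: addr_gt0.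
have dF y : 0 < y < 1 -> is_derive y 1 (jacobi (a + 1) (b + 1) p)
    (jacobi a b (jacobi_deriv (a + 1) (b + 1) p) y).
  by move=> /(is_derive_jacobi (a + 1) (b + 1) p); rewrite !addrK.
have := @continuous_FTC2 R (jacobi a b (jacobi_deriv (a + 1) (b + 1) p))
  (jacobi (a + 1) (b + 1) p) 0 1 ltr01.
rewrite /jacobi_integral /Rintegral => FTC.
(* The endpoints are negligible, so the integral may be taken over [0, 1], as the fundamental
   theorem of calculus requires. *)
rewrite -(@integral_itv_bndoo R 0 1 _ true false); last first.
  have /measurable_int := integrable_jacobi (jacobi_deriv (a + 1) (b + 1) p) a0 b0.
  exact.
rewrite FTC.
- by rewrite /jacobi subrr !powR0 ?gt_eqF // !(mulr0, mul0r) subee.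
- exact: continuous_jacobi.
- split.
  + by move=> y; rewrite in_itv /= => /dF [].
  + exact: cvg_at_right_jacobi.
  + exact: cvg_at_left_jacobi.
- by move=> y; rewrite in_itv /= => /dF [_ ]; rewrite derive1E.
Qed.

(** This is the vanishing of the integral of a derivative, for p = X^k. It is the recurrence that
    [moment_functional_pearson] asks for. *)
Lemma jacobi_moment_rec a b k : 0 < a -> 0 < b ->
  (a + 1 + k%:R) * jacobi_moment a b k =
  (a + b + 2 + k%:R) * jacobi_moment a b k.+1.
Proof.
move=> a0 b0; have := jacobi_integral_deriv 'X^k a0 b0.
have -> : jacobi_deriv (a + 1) (b + 1) 'X^k =
    (a + 1 + k%:R) *: 'X^k + (- (a + b + 2 + k%:R)) *: 'X^(k.+1).
  rewrite /jacobi_deriv derivXn -!mul_polyC.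
  by case: k => [|k] /=; rewrite ?mulr0n ?exprS; ring.
rewrite jacobi_integralD // !jacobi_integralZ // mulNr => /eqP.
by rewrite subr_eq0 => /eqP.
Qed.

(* On (0, 1) every derivative is again of the form [jacobi a' b' q], with
   smaller exponents. *)
Lemma smooth_jacobi (f : R -> R) a b p :
  (forall y, 0 < y < 1 -> f y = jacobi a b p y) -> smooth01 f.
Proof.
move=> fE k y y01.
suff [q qE] : exists q, forall x : R, 0 < x < 1 ->
    derive1n k f x = jacobi (a - k%:R) (b - k%:R) q x.
  have [d _] := is_derive_jacobi (a - k%:R) (b - k%:R) q y01.
  apply: near_eq_derivable d.
  near=> x; rewrite qE //; near: x; exact: near_in_itvoo.
elim: k => [|k [q qE]]; first by exists p => x /fE; rewrite !subr0.
exists (jacobi_deriv (a - k%:R) (b - k%:R) q) => x x01.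
rewrite /derive1n iterS -/(derive1n k _) derive1E.
have [_ dE] := is_derive_jacobi (a - k%:R) (b - k%:R) q x01.
rewrite (@near_eq_derive _ _ _ _ (jacobi (a - k%:R) (b - k%:R) q)) ?dE.
  by rewrite -!addrA -!opprD -!natr1.
near=> z; rewrite qE //; near: z; exact: near_in_itvoo.
Unshelve. all: by end_near. Qed.

Lemma jacobi_moment_shift a b k : 0 < a -> 0 < b ->
  jacobi_moment (a + 1) (b + 1) k =
  jacobi_moment a b k.+1 - jacobi_moment a b k.+2.
Proof.
move=> a0 b0; rewrite /jacobi_moment.
rewrite -[in RHS]mulN1r -jacobi_integralZ // -jacobi_integralD //.
apply: eq_Rintegral => y; rewrite inE /= in_itv /= => /andP[y0 y1].
have powRS (x c : R) : 0 < x -> x `^ (c + 1) = x `^ c * x.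
  move=> x0; rewrite -[X in _ * X](@powRr1 _ x) ?ltW // -powRD //.
  by rewrite (gt_eqF x0) implybT.
rewrite /jacobi !powRS ?subr_gt0 // hornerD hornerZ !hornerXn.
by rewrite (exprS _ k.+1) (exprS _ k); ring.
Qed.

End JacobiWeight.

(** * From integrals of matrix functions to moment functionals *)

Section JacobiMoments.
Variables (R : realType) (m : nat) (a b : R) (a0 : 0 < a) (b0 : 0 < b).
Local Notation C := R[i].
Local Notation M := 'M[C]_m.+1.
Implicit Types (F : {poly M}) (W : R -> M).

Definition jacobi_momentC k : C := (jacobi_moment a b k)%:C.

(** The real-linear [phi] stands for both [complex.Re] and [complex.Im], so one argument serves the
    two parts of a complex integral. *)
Lemma real_linear_jacobi (phi : C -> R) F i j (y : R) :
  phi 0 = 0 -> {morph phi : z1 z2 / z1 + z2} ->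
  (forall x z, phi (x%:C * z) = x * phi z) ->
  phi ((y `^ a * (1 - y) `^ b)%:C * evalmx F y i j) =
  jacobi a b (\poly_(k < size F) phi (F`_k i j)) y.
Proof.
move=> phi0 phiD phiZ; rewrite phiZ evalmxE summxE.
rewrite (big_morph phi phiD phi0) /jacobi horner_poly; congr (_ * _).
by apply: eq_bigr => k _; rewrite mxE -rmorphXn phiZ mulrC.
Qed.

Lemma real_linear_moment (phi : C -> R) F i j :
  phi 0 = 0 -> {morph phi : z1 z2 / z1 + z2} ->
  (forall x z, phi (x%:C * z) = x * phi z) ->
  phi (moment_functional jacobi_momentC F i j) =
  jacobi_integral a b (\poly_(k < size F) phi (F`_k i j)).
Proof.
move=> phi0 phiD phiZ.
rewrite (@jacobi_integral_poly _ a b _ (fun k => phi (F`_k i j))) // summxE.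
rewrite (big_morph phi phiD phi0); apply: eq_bigr => k _.
by rewrite mxE phiZ.
Qed.

Lemma ReD : {morph (@complex.Re R) : z1 z2 / z1 + z2}.
Proof. by move=> [x1 y1] [x2 y2]. Qed.

Lemma ImD : {morph (@complex.Im R) : z1 z2 / z1 + z2}.
Proof. by move=> [x1 y1] [x2 y2]. Qed.

Lemma ReZ x (z : C) : complex.Re (x%:C * z) = x * complex.Re z.
Proof. by case: z => u v /=; rewrite mul0r subr0. Qed.

Lemma ImZ x (z : C) : complex.Im (x%:C * z) = x * complex.Im z.
Proof. by case: z => u v /=; rewrite mul0r addr0. Qed.

Lemma integralC01_jacobi (f : R -> C) F i j :
  (forall y, 0 < y < 1 ->
     f y = (y `^ a * (1 - y) `^ b)%:C * evalmx F y i j) ->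
  integralC01 f = moment_functional jacobi_momentC F i j.
Proof.
move=> fE; set z := moment_functional _ _ _ _.
rewrite (_ : z = complex.Re z +i* complex.Im z); last by case: (z).
rewrite /z !real_linear_moment //;
  [|exact: ImD|exact: ImZ|exact: ReD|exact: ReZ].
congr (_ +i* _); apply: eq_Rintegral => y; rewrite inE /= in_itv /= => /fE ->.
  by rewrite real_linear_jacobi //; [exact: ReD|exact: ReZ].
by rewrite real_linear_jacobi //; [exact: ImD|exact: ImZ].
Qed.

Lemma integrableC01_jacobi (f : R -> C) F i j :
  (forall y, 0 < y < 1 ->
     f y = (y `^ a * (1 - y) `^ b)%:C * evalmx F y i j) ->
  integrableC01 f.
Proof.
move=> fE; split.
  apply: eq_integrable (integrable_jacobi
    (\poly_(k < size F) complex.Re (F`_k i j)) a0 b0) => // y.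
  rewrite inE /= in_itv /= => /fE ->.
  by rewrite real_linear_jacobi //; [exact: ReD|exact: ReZ].
apply: eq_integrable (integrable_jacobi
  (\poly_(k < size F) complex.Im (F`_k i j)) a0 b0) => // y.
rewrite inE /= in_itv /= => /fE ->.
by rewrite real_linear_jacobi //; [exact: ImD|exact: ImZ].
Qed.

(** The passage from analysis to algebra: P W Q^* is the scalar weight times the values of the
    polynomial P S Q^*. *)
Lemma inner_jacobi W S P Q :
  (forall y, 0 < y < 1 -> W y = (y `^ a * (1 - y) `^ b)%:C *: evalmx S y) ->
  inner W P Q = moment_form jacobi_momentC S P Q.
Proof.
move=> WE; apply/matrixP => i j; rewrite mxE.
apply: integralC01_jacobi => y /WE ->.
by rewrite -scalemxAr -scalemxAl mxE !evalmxM evalmx_adjp.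
Qed.

Lemma finite_moments_jacobi W S :
  (forall y, 0 < y < 1 -> W y = (y `^ a * (1 - y) `^ b)%:C *: evalmx S y) ->
  finite_moments W.
Proof.
move=> WE k i j; apply: (@integrableC01_jacobi _ ('X^k * S) i j) => y /WE ->.
rewrite mxE mulrCA evalmxM /evalmx hornerXn -(rmorphXn (@scalar_mx C m.+1)).
by rewrite -mulmxE mul_scalar_mx mxE rmorphXn.
Qed.

Lemma smooth_jacobi_mx W S :
  (forall y, 0 < y < 1 -> W y = (y `^ a * (1 - y) `^ b)%:C *: evalmx S y) ->
  smoothmx01 W.
Proof.
move=> WE i j; split.
  apply: (@smooth_jacobi _ _ a b (\poly_(k < size S) complex.Re (S`_k i j))).
  move=> y /WE ->; rewrite mxE.
  by rewrite real_linear_jacobi //; [exact: ReD|exact: ReZ].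
apply: (@smooth_jacobi _ _ a b (\poly_(k < size S) complex.Im (S`_k i j))).
move=> y /WE ->; rewrite mxE.
by rewrite real_linear_jacobi //; [exact: ImD|exact: ImZ].
Qed.

End JacobiMoments.

(** * Explicit two by two matrices and matrix polynomials *)

Section TwoByTwo.

Lemma mx22_eq (T : nzRingType) (A : 'M[T]_2) :
  A = mx22 (A 0 0) (A 0 1) (A 1 0) (A 1 1).
Proof.
apply/matrixP => i j; rewrite mxE.
by case: i => [[|[|//]] hi]; case: j => [[|[|//]] hj] /=;
   congr (A _ _); apply: val_inj.
Qed.

Lemma mx22P (T : nzRingType) (A : 'M[T]_2) (a b c d : T) :
  A 0 0 = a -> A 0 1 = b -> A 1 0 = c -> A 1 1 = d -> A = mx22 a b c d.
Proof. by move=> <- <- <- <-; exact: mx22_eq. Qed.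

Lemma mulmx22 (T : nzRingType) (a b c d a' b' c' d' : T) :
  mx22 a b c d * mx22 a' b' c' d' =
  mx22 (a * a' + b * c') (a * b' + b * d') (c * a' + d * c') (c * b' + d * d').
Proof.
rewrite -mulmxE [LHS]mx22_eq.
by congr mx22; rewrite !mxE !big_ord_recl big_ord0 !mxE /= addr0.
Qed.

Lemma addmx22 (T : nzRingType) (a b c d a' b' c' d' : T) :
  mx22 a b c d + mx22 a' b' c' d' = mx22 (a + a') (b + b') (c + c') (d + d').
Proof. by rewrite [LHS]mx22_eq; congr mx22; rewrite !mxE. Qed.

Lemma oppmx22 (T : nzRingType) (a b c d : T) :
  - mx22 a b c d = mx22 (- a) (- b) (- c) (- d).
Proof. by rewrite [LHS]mx22_eq; congr mx22; rewrite !mxE. Qed.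

Lemma scalemx22 (T : nzRingType) (x a b c d : T) :
  x *: mx22 a b c d = mx22 (x * a) (x * b) (x * c) (x * d).
Proof. by rewrite [LHS]mx22_eq; congr mx22; rewrite !mxE. Qed.

Lemma scalar_mx22 (T : nzRingType) (a : T) : a%:M = mx22 a 0 0 a.
Proof. by rewrite [LHS]mx22_eq; congr mx22; rewrite !mxE. Qed.

Definition mx22E (T : nzRingType) :=
  (@mulmx22 T, @addmx22 T, @oppmx22 T, @scalemx22 T, @scalar_mx22 T).

Variable R : realType.
Local Notation C := R[i].
Implicit Types (a b c d x y : R) (p q r s : {poly R}).

(** Complex matrices with real entries: their identities reduce to four identities in [R], within
    reach of [field]. *)
Definition real_mx22 a b c d : 'M[C]_2 := mx22 a%:C b%:C c%:C d%:C.

Lemma mul_real_mx22 a b c d a' b' c' d' :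
  real_mx22 a b c d * real_mx22 a' b' c' d' =
  real_mx22 (a * a' + b * c') (a * b' + b * d')
            (c * a' + d * c') (c * b' + d * d').
Proof. by rewrite mulmx22 /real_mx22 !rmorphD !rmorphM. Qed.

Lemma add_real_mx22 a b c d a' b' c' d' :
  real_mx22 a b c d + real_mx22 a' b' c' d' =
  real_mx22 (a + a') (b + b') (c + c') (d + d').
Proof. by rewrite addmx22 /real_mx22 !rmorphD. Qed.

Lemma opp_real_mx22 a b c d :
  - real_mx22 a b c d = real_mx22 (- a) (- b) (- c) (- d).
Proof. by rewrite oppmx22 /real_mx22 !rmorphN. Qed.

Lemma scale_real_mx22 x a b c d :
  x%:C *: real_mx22 a b c d = real_mx22 (x * a) (x * b) (x * c) (x * d).
Proof. by rewrite scalemx22 /real_mx22 !rmorphM. Qed.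

Lemma scalar_real_mx22 a : (a%:C)%:M = real_mx22 a 0 0 a.
Proof. exact: scalar_mx22. Qed.

Lemma adj_real_mx22 a b c d : (real_mx22 a b c d) ^t* = real_mx22 a c b d.
Proof. by apply: mx22P; rewrite !mxE /= conj_Creal // complex_real. Qed.

Definition real_mx22E := (mul_real_mx22, add_real_mx22, opp_real_mx22,
  scale_real_mx22, scalar_real_mx22, adj_real_mx22).

Definition poly_mx22 p q r s : {poly 'M[C]_2} :=
  \poly_(k < maxn (maxn (size p) (size q)) (maxn (size r) (size s)))
    real_mx22 p`_k q`_k r`_k s`_k.

Lemma real_mx22_0 : real_mx22 0 0 0 0 = 0.
Proof. by apply/esym/mx22P; rewrite mxE. Qed.

Lemma coef_poly_mx22 p q r s k :
  (poly_mx22 p q r s)`_k = real_mx22 p`_k q`_k r`_k s`_k.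
Proof.
rewrite coef_poly; case: ltnP => //; rewrite !geq_max.
by move=> /andP[/andP[hp hq] /andP[hr hs]]; rewrite !nth_default ?real_mx22_0.
Qed.

Lemma size_poly_mx22 p q r s n :
  (size p <= n)%N -> (size q <= n)%N -> (size r <= n)%N -> (size s <= n)%N ->
  (size (poly_mx22 p q r s) <= n)%N.
Proof.
move=> hp hq hr hs; apply/leq_sizeP => k nk; rewrite coef_poly_mx22.
by rewrite !nth_default ?(leq_trans _ nk) ?real_mx22_0.
Qed.

Lemma deriv_poly_mx22 p q r s :
  (poly_mx22 p q r s)^`() = poly_mx22 p^`() q^`() r^`() s^`().
Proof.
apply/polyP => k; rewrite coef_deriv !coef_poly_mx22 !coef_deriv.
by apply: mx22P; rewrite mulmxnE mxE /= rmorphMn.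
Qed.

Lemma adj_poly_mx22 p q r s : adjp (poly_mx22 p q r s) = poly_mx22 p r q s.
Proof.
by apply/polyP => k; rewrite coef_adjp !coef_poly_mx22 adj_real_mx22.
Qed.

Lemma evalmx_poly_mx22 p q r s y :
  evalmx (poly_mx22 p q r s) y = real_mx22 p.[y] q.[y] r.[y] s.[y].
Proof.
set n := maxn (maxn (size p) (size q)) (maxn (size r) (size s)).
have := leqnn n; rewrite {1}/n !geq_max => /andP[/andP[hp hq] /andP[hr hs]].
rewrite /evalmx (horner_coef_wide _ (size_poly _ _)) -/n.
rewrite (horner_coef_wide _ hp) (horner_coef_wide _ hq).
rewrite (horner_coef_wide _ hr) (horner_coef_wide _ hs).
by apply: mx22P; rewrite summxE rmorph_sum; apply: eq_bigr => k _;
  rewrite coef_poly_mx22 -(rmorphXn (@scalar_mx C 2)) -mulmxE mul_mx_scalar;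
  rewrite !mxE mulrC rmorphM rmorphXn.
Qed.

End TwoByTwo.

(** * Algebraic identities of the kappa family *)

Section KappaFamilyPearson.
Variables (R : realType) (n : nat) (hn : (3 <= n)%N).
Implicit Types (kappa y : R).
Local Notation C := R[i].
Local Notation nR := (n%:R : R).

Let n1_neq0 : nR - 1 != 0.
Proof. by rewrite subr_eq0 (eqr_nat R n 1); case: n hn => [|[|]]. Qed.

Let n2_neq0 : nR - 2 != 0.
Proof. by rewrite subr_eq0 eqr_nat; case: n hn => [|[|[|]]]. Qed.

(** This is [Psi0 T Psi0^*] multiplied out: square roots of y meet only in pairs, and [l / (n - 2)]
    is the lower right entry of [Psi0]. *)
Definition kappa_S kappa : {poly 'M[C]_2} :=
  let l : {poly R} := (nR - 1) *: 'X - 1 in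
  let p : {poly R} := 'X + (2 / (kappa + 2)) *: l in
  poly_mx22 ('X + (2 * (nR - 2) / (kappa + 2))%:P) p p
    ('X + (2 / ((kappa + 2) * (nR - 2))) *: (l * l)).

(** With S = [kappa_S kappa] and F1 the first-order coefficient of D, this is S F1^* - F1 S divided
    by 2 sigma; it is constant and skew. *)
Definition kappa_H kappa : {poly 'M[C]_2} :=
  let h := (2 * (nR - 1) / (kappa + 2))%:P in poly_mx22 0 h (- h) 0.

(* [Phi = sigma (Psi0^* )^-1 diag(1, r) Psi0^*] for
   [r = (kappa + 2) / (kappa + 3)]. *)
Definition kappa_Phi kappa : {poly 'M[C]_2} :=
  let r := (kappa + 2) / (kappa + 3) in
  let q : {poly R} := (nR - 2)^-1 *: ((nR - 1) *: 'X - 1) in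
  let s : {poly R} := (- (nR - 2) / (nR - 1)) *: 'X in
  poly_mx22 (s * (q - r%:P)) (s * ((1 - r) *: q))
            (s * (r - 1)%:P) (s * (r *: q - 1)).

(* Found by solving [S Psi = rho S_(kappa + 1) + sigma S_(kappa + 1)'] for the
   coefficients of [Psi]. *)
Definition kappa_Psi kappa : {poly 'M[C]_2} :=
  let k3 := (nR - 1) * (kappa + 3) in
  poly_mx22
    ((((nR - 1) * (kappa + 2) ^+ 2 + 2 * kappa + 2 * nR + 1) / k3)%:P
       - (2 * kappa + 2 * nR + 1) *: 'X)
    (((2 * kappa + 3) / k3)%:P - ((kappa + 1) / (kappa + 3)) *: 'X)
    ((2 * kappa + 2 * nR + 1) * (nR - 2) / k3)%:P
    ((((nR - 2) * (2 * kappa + 3) + (nR - 1) * (kappa + 2) ^+ 2) / k3)%:P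
       - ((2 * kappa + 2 * nR + 2) * (kappa + 2) / (kappa + 3)) *: 'X).

Local Notation rho kappa :=
  (pearson_rho 1 (kappa + 2)%:C (2 * kappa + 2 * nR)%:C).
Local Notation sigma := (pearson_sigma R 1).

Lemma evalmx_rho kappa y : evalmx (rho kappa) y =
  real_mx22 ((kappa + 2) - (2 * kappa + 2 * nR) * y) 0 0
            ((kappa + 2) - (2 * kappa + 2 * nR) * y).
Proof.
rewrite /pearson_rho evalmxD evalmxN evalmxM !evalmxC evalmxX !real_mx22E.
by rewrite !(mulr0, mul0r, addr0, add0r, oppr0).
Qed.

Lemma evalmx_sigma y : evalmx sigma y = real_mx22 (y * (1 - y)) 0 0 (y * (1 - y)).
Proof.
rewrite /pearson_sigma evalmxM evalmxD evalmxN -polyC1 !evalmxC evalmxX.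
rewrite -[1]/((1 : R)%:C)%:M !real_mx22E.
by rewrite !(mulr0, mul0r, addr0, add0r, oppr0).
Qed.

Lemma evalmx_opF1 kappa y : evalmx (opF1 (Dkappa n kappa)) y =
  real_mx22 ((2 * nR - 1) / (nR - 1) + kappa - y * (2 * nR + 1 + 2 * kappa))
            ((nR - 2) / (nR - 1))
            (1 / (nR - 1) + y)
            ((3 * nR - 4) / (nR - 1) + kappa - y * (2 * nR + 2 + 2 * kappa)).
Proof.
rewrite /Dkappa /= evalmxD evalmxN evalmxM !evalmxC evalmxX /Cmx /Umx.
rewrite !mx22E; congr mx22;
rewrite ?(mulr0, mul0r, addr0, add0r, oppr0, mulr1, mul1r, subr0);
rewrite ?(rmorphD, rmorphN, rmorphM, fmorphV, rmorph_nat, rmorph1) //=; ring.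
Qed.

Lemma evalmx_opF0 kappa y : evalmx (opF0 (Dkappa n kappa)) y =
  real_mx22 (- (kappa * (2 * nR + 1) + kappa * (kappa - 1))) 0
    kappa (- (2 * nR - 2 + kappa * (2 * nR + 2) + kappa * (kappa - 1))).
Proof.
rewrite /Dkappa /= -polyCN evalmxC /Vmx /Umx.
rewrite !mx22E; congr mx22;
rewrite ?(mulr0, mul0r, addr0, add0r, oppr0, mulr1, mul1r, subr0);
rewrite ?(rmorphD, rmorphN, rmorphM, fmorphV, rmorph_nat, rmorph1) //=; ring.
Qed.

Lemma kappa_S_adj kappa : adjp (kappa_S kappa) = kappa_S kappa.
Proof. exact: adj_poly_mx22. Qed.

Let horner1 y : (1 : {poly R}).[y] = 1.
Proof. by rewrite -polyC1 hornerC. Qed.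

Let hornerRE := (hornerD, hornerN, hornerM, hornerZ, hornerC, hornerX, horner0,
  horner1).

Let evalE := (evalmxM, evalmxD, evalmxN, evalmx_adjp, deriv_poly_mx22,
  evalmx_poly_mx22, evalmx_rho, evalmx_sigma, evalmx_opF1, evalmx_opF0).

(** This identity and the next two are the hypotheses of [moment_form_symmetric], checked entry by
    entry at real points. *)
Lemma kappa_opF1_S kappa : 0 <= kappa ->
  opF1 (Dkappa n kappa) * kappa_S kappa =
  rho kappa * kappa_S kappa + sigma * (kappa_S kappa)^`() - sigma * kappa_H kappa.
Proof.
move=> k0; have k2 : kappa + 2 != 0 by rewrite gt_eqF // ltr_wpDl.
apply: evalmx_inj => y; rewrite /kappa_S /kappa_H.
rewrite !(evalE, real_mx22E) !poly.derivE !hornerRE.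
by congr real_mx22; field; rewrite ?k2 ?n1_neq0 ?n2_neq0.
Qed.

Lemma kappa_S_adj_opF1 kappa : 0 <= kappa ->
  kappa_S kappa * adjp (opF1 (Dkappa n kappa)) =
  rho kappa * kappa_S kappa + sigma * (kappa_S kappa)^`() + sigma * kappa_H kappa.
Proof.
move=> k0; have k2 : kappa + 2 != 0 by rewrite gt_eqF // ltr_wpDl.
apply: evalmx_inj => y; rewrite /kappa_S /kappa_H.
rewrite !(evalE, real_mx22E) !poly.derivE !hornerRE.
by congr real_mx22; field; rewrite ?k2 ?n1_neq0 ?n2_neq0.
Qed.

Lemma kappa_H_opF0 kappa : 0 <= kappa ->
  rho kappa * kappa_H kappa + sigma * (kappa_H kappa)^`() =
  kappa_S kappa * adjp (opF0 (Dkappa n kappa)) -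
  opF0 (Dkappa n kappa) * kappa_S kappa.
Proof.
move=> k0; have k2 : kappa + 2 != 0 by rewrite gt_eqF // ltr_wpDl.
apply: evalmx_inj => y; rewrite /kappa_S /kappa_H.
rewrite !(evalE, real_mx22E) !poly.derivE !hornerRE.
by congr real_mx22; field; rewrite ?k2 ?n1_neq0 ?n2_neq0.
Qed.

(** Raising kappa by one multiplies T by diag(1, r). Conjugating this factor by [Psi0^*] divides by
    [q - 1], a multiple of y - 1, which sigma clears. *)
Lemma kappa_S_shift kappa : 0 <= kappa ->
  sigma * kappa_S (kappa + 1) = kappa_S kappa * kappa_Phi kappa.
Proof.
move=> k0; have k2 : kappa + 2 != 0 by rewrite gt_eqF // ltr_wpDl.
have k3 : kappa + 3 != 0 by rewrite gt_eqF // ltr_wpDl.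
have k12 : kappa + 1 + 2 = kappa + 3 by ring.
apply: evalmx_inj => y; rewrite /kappa_S /kappa_Phi k12.
rewrite !(evalE, real_mx22E) !hornerRE.
by congr real_mx22; field; rewrite ?k2 ?k3 ?n1_neq0 ?n2_neq0.
Qed.

Lemma kappa_S_shift_deriv kappa : 0 <= kappa ->
  rho kappa * kappa_S (kappa + 1) + sigma * (kappa_S (kappa + 1))^`() =
  kappa_S kappa * kappa_Psi kappa.
Proof.
move=> k0; have k2 : kappa + 2 != 0 by rewrite gt_eqF // ltr_wpDl.
have k3 : kappa + 3 != 0 by rewrite gt_eqF // ltr_wpDl.
have k12 : kappa + 1 + 2 = kappa + 3 by ring.
apply: evalmx_inj => y; rewrite /kappa_S /kappa_Psi k12.
rewrite !(evalE, real_mx22E) !poly.derivE !hornerRE.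
by congr real_mx22; field; rewrite ?k2 ?k3 ?n1_neq0 ?n2_neq0.
Qed.

Lemma size_affine (T : nzRingType) (b c : T) :
  (size (c%:P + b%:P * 'X)%R <= 2)%N.
Proof.
apply/leq_sizeP => [[|[|j]]] // _.
by rewrite coefD coefMX !coefC /= addr0.
Qed.

Lemma size_kappa_Phi kappa : (size (kappa_Phi kappa) <= 3)%N.
Proof.
have mul3 (p q : {poly R}) : (size p <= 2)%N -> (size q <= 2)%N ->
    (size (p * q)%R <= 3)%N.
  by move=> hp hq; apply: leq_trans (size_polyMleq _ _) _; lia.
have affine (p : {poly R}) b c : p = c%:P + b%:P * 'X -> (size p <= 2)%N.
  by move=> ->; exact: size_affine.
rewrite /kappa_Phi; set r := (kappa + 2) / _.
set d := (_ - 2)^-1; set e := - _ / _.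
(* Each entry is a product of two affine factors; the witnesses are the slope and the constant term
   of each. *)
by apply: size_poly_mx22; apply: mul3;
  [apply: (affine _ e 0)|apply: (affine _ (d * (nR - 1)) (- d - r))|
   apply: (affine _ e 0)|apply: (affine _ ((1 - r) * d * (nR - 1)) (- ((1 - r) * d)))|
   apply: (affine _ e 0)|apply: (affine _ 0 (r - 1))|
   apply: (affine _ e 0)|apply: (affine _ (r * d * (nR - 1)) (- (r * d) - 1))];
  rewrite -?mul_polyC; ring.
Qed.

Lemma size_kappa_Psi kappa : (size (kappa_Psi kappa) <= 2)%N.
Proof.
have affine b c : (size (c%:P - b *: 'X : {poly R})%R <= 2)%N.
  by rewrite -scaleNr -mul_polyC; exact: size_affine.
by apply: size_poly_mx22; rewrite ?affine // (leq_trans (size_polyC_leq1 _)).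
Qed.

Lemma size_Dkappa kappa :
  [/\ (size (opF2 (Dkappa n kappa)) <= 3)%N,
      (size (opF1 (Dkappa n kappa)) <= 2)%N
    & (size (opF0 (Dkappa n kappa)) <= 1)%N].
Proof.
split.
- rewrite /=; apply: leq_trans (size_polyMleq _ _) _.
  have := size_affine (-1 : 'M[C]_2) 1; rewrite polyCN polyC1 mulN1r.
  by rewrite size_polyX add2n.
- by rewrite /= -commr_polyX -mulNr -polyCN; exact: size_affine.
- by rewrite /= -polyCN size_polyC_leq1.
Qed.

End KappaFamilyPearson.

(** * Positivity of the weight and the two claims for the kappa family *)

Section KappaFamily.
Variables (R : realType) (n : nat) (hn : (3 <= n)%N).
Implicit Types (kappa y : R).
Local Notation C := R[i].
Local Notation nR := (n%:R : R).

Let n3 : 3 <= nR.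
Proof. by rewrite (ler_nat R 3 n). Qed.

Lemma Wkappa_jacobi kappa y : 0 <= kappa -> 0 < y < 1 ->
  Wkappa n kappa y =
  (y `^ (kappa + 1) * (1 - y) `^ (kappa + 2 * nR - 3))%:C *:
  evalmx (kappa_S n kappa) y.
Proof.
move=> k0 /andP[y0 y1]; rewrite /Wkappa; congr (_ *: _).
have k2 : kappa + 2 != 0 by rewrite gt_eqF // ltr_wpDl.
have n2 : nR - 2 != 0 by rewrite gt_eqF // subr_gt0 (lt_le_trans _ n3) // ltr_nat.
rewrite (_ : Psi0 n y = real_mx22 (Num.sqrt y) 1 (Num.sqrt y)
  ((y * (nR - 1) - 1) / (nR - 2))) //.
rewrite (_ : Tmx n kappa = real_mx22 1 0 0 (2 * (nR - 2) / (kappa + 2))) //.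
rewrite !mulmxE !real_mx22E evalmx_poly_mx22.
rewrite !(mulr0, mul0r, addr0, add0r, mulr1, mul1r) -!expr2 sqr_sqrtr ?ltW //.
rewrite !(hornerD, hornerN, hornerM, hornerZ, hornerC, hornerX).
by congr real_mx22; field; rewrite ?k2 ?n2.
Qed.

Lemma diag_form2 (u : 'rV[C]_2) (t : R) :
  (u *m real_mx22 1 0 0 t *m u ^t*) 0 0 = `|u 0 0| ^+ 2 + t%:C * `|u 0 1| ^+ 2.
Proof.
rewrite !normCK !mxE !big_ord_recl big_ord0 !mxE !big_ord_recl !big_ord0 !mxE /=.
by rewrite (_ : lift ord0 ord0 = 1 :> 'I_2) ?rmorph1; [ring|exact: val_inj].
Qed.

(** With u = v [Psi0], the form is a positive multiple of |u_0|^2 + t |u_1|^2 with t > 0, and u is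
    nonzero because [Psi0] is invertible on (0, 1). *)
Lemma posdef_Wkappa kappa y : 0 <= kappa -> 0 < y < 1 ->
  posdefmx (Wkappa n kappa y).
Proof.
move=> k0 /andP[y0 y1].
have n2 : 0 < nR - 2 by rewrite subr_gt0 (lt_le_trans _ n3) // ltr_nat.
set t : R := 2 * (nR - 2) / (kappa + 2).
have t0 : 0 < t by apply: divr_gt0; [apply: mulr_gt0|apply: ltr_wpDl].
have TE : Tmx n kappa = real_mx22 1 0 0 t by exact: erefl.
split.
  rewrite /Wkappa adjmx_scale_real; congr (_ *: _).
  by rewrite !trmx_mul !map_mxM /= trmxCK TE adj_real_mx22 mulmxA.
move=> v v0; rewrite /Wkappa -scalemxAr -scalemxAl mxE mulr_gt0 //.
  by rewrite ltcR mulr_gt0 // powR_gt0 // subr_gt0.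
pose u := v *m Psi0 n y.
have uE : u ^t* = (Psi0 n y) ^t* *m v ^t* by rewrite trmx_mul map_mxM.
rewrite !mulmxA -(mulmxA _ _ (v ^t*)) -uE -/u.
have v01 : (v 0 0 + v 0 1) * (Num.sqrt y)%:C = u 0 0.
  by rewrite mxE !big_ord_recl big_ord0 !mxE /= addr0 mulrDl; congr (_ + v _ _ * _);
     apply: val_inj.
set q := (y * (nR - 1) - 1) / (nR - 2).
have v1q : v 0 0 + v 0 1 * q%:C = u 0 1.
  rewrite mxE !big_ord_recl big_ord0 !mxE /= addr0 mulr1; congr (_ + v _ _ * _).
  exact: val_inj.
clearbody u; rewrite TE diag_form2.
(* If u_0 = 0 then v_0 = - v_1, since y > 0; hence u_1 = v_1 (q - 1), and q differs from 1 as y <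
   1. *)
have [u0|u0] := eqVneq (u 0 0) 0; last first.
  rewrite ltr_pwDl ?exprn_gt0 ?normr_gt0 // mulr_ge0 ?exprn_ge0 //.
  by rewrite lecR ltW.
rewrite u0 normr0 expr0n add0r mulr_gt0 ?ltcR // exprn_gt0 // normr_gt0 -v1q.
move/eqP: v01; rewrite u0 mulf_eq0 => /orP[|]; last first.
  by rewrite fmorph_eq0 sqrtr_eq0 leNgt y0.
rewrite addr_eq0 => /eqP v0E; apply: contraNneq v0.
have q1 : q - 1 != 0.
  have -> : q - 1 = (nR - 1) * (y - 1) / (nR - 2) by rewrite /q; field; rewrite gt_eqF.
  rewrite !mulf_neq0 ?invr_eq0 ?(gt_eqF n2) // ?(lt_eqF y1) //.
    by rewrite subr_eq0 gt_eqF // (lt_le_trans _ n3) // ltr1n.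
  by rewrite subr_eq0 lt_eqF.
rewrite v0E addrC -[X in _ - X]mulr1 -mulrBr => /eqP.
rewrite mulf_eq0 => /orP[/eqP v1|]; last first.
  by rewrite -(rmorph1 (real_complex R)) -rmorphB fmorph_eq0 (negPf q1).
apply/eqP/rowP => i; rewrite mxE.
by case: i => [[|[|//]] hi]; [move: v0E; rewrite v1 oppr0 => v0|move: v1 => v0];
   rewrite -[RHS]v0; congr (v _ _); apply: val_inj.
Qed.

Local Notation mu kappa := (jacobi_momentC (kappa + 1) (kappa + 2 * nR - 3)).

Lemma kappa_exponents_gt0 kappa :
  0 <= kappa -> 0 < kappa + 1 /\ 0 < kappa + 2 * nR - 3.
Proof. by move=> k0; have := n3; split; lra. Qed.

(** For the exponents a = kappa + 1 and b = kappa + 2n - 3, the coefficients of rho are a + 1 and a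
    + b + 2. *)
Lemma kappa_moment_rec kappa k : 0 <= kappa ->
  ((kappa + 2)%:C + k%:R) * mu kappa k =
  ((2 * kappa + 2 * nR)%:C + k%:R) * mu kappa k.+1.
Proof.
move=> /kappa_exponents_gt0[a0 b0].
rewrite -!(rmorph_nat (real_complex R) k) -!(rmorphD (real_complex R)).
rewrite -!(rmorphM (real_complex R)); congr (_ %:C).
have -> : kappa + 2 = kappa + 1 + 1 by ring.
have -> : 2 * kappa + 2 * nR = kappa + 1 + (kappa + 2 * nR - 3) + 2 by ring.
exact: jacobi_moment_rec.
Qed.

Lemma kappa_moment_shift kappa k : 0 <= kappa ->
  mu (kappa + 1) k = mu kappa k.+1 - mu kappa k.+2.
Proof.
move=> /kappa_exponents_gt0[a0 b0]; rewrite /jacobi_momentC -rmorphB.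
rewrite -(jacobi_moment_shift k a0 b0).
by have -> : kappa + 1 + 2 * nR - 3 = kappa + 2 * nR - 3 + 1 by ring.
Qed.

Lemma inner_Wkappa kappa P Q : 0 <= kappa ->
  inner (Wkappa n kappa) P Q = moment_form (mu kappa) (kappa_S n kappa) P Q.
Proof.
move=> k0; have [a0 b0] := kappa_exponents_gt0 k0.
by apply: (inner_jacobi a0 b0) => y; exact: Wkappa_jacobi.
Qed.

Lemma kappa_classical_pair kappa : 0 <= kappa ->
  classical_pair (Wkappa n kappa) (Dkappa n kappa).
Proof.
move=> k0; have WE := fun y => @Wkappa_jacobi kappa y k0.
have [a0 b0] := kappa_exponents_gt0 k0.
split; [split|exact: size_Dkappa|].
- exact: smooth_jacobi_mx WE.
- by move=> y; exact: posdef_Wkappa.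
- exact: (finite_moments_jacobi a0 b0 WE).
- move=> P Q; rewrite !inner_Wkappa //.
  have rec := fun k => kappa_moment_rec k k0.
  exact: (moment_form_symmetric P Q rec (kappa_opF1_S hn k0)
    (kappa_S_adj_opF1 hn k0) (kappa_H_opF0 hn k0)).
Qed.

Lemma mvop_Wkappa kappa P : 0 <= kappa ->
  mvop (Wkappa n kappa) P <-> moment_orthogonal (mu kappa) (kappa_S n kappa) P.
Proof.
move=> k0; split=> -[szP lcP orthP]; split=> // d e /orthP;
  by rewrite inner_Wkappa.
Qed.

(** The index shift gives the d-th derivative degree d, so that the derivatives again form a full
    orthogonal sequence. *)
Lemma mvop_deriv kappa P : 0 <= kappa ->
  mvop (Wkappa n kappa) P -> mvop (Wkappa n (kappa + 1)) (fun d => (P d.+1)^`()).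
Proof.
move=> k0 /(mvop_Wkappa _ k0) orthP; have k1 : 0 <= kappa + 1 by rewrite addr_ge0.
apply/(mvop_Wkappa _ k1).
apply: (moment_orthogonal_deriv (fun k => kappa_moment_rec k k0) _ _
  (kappa_S_adj _ _) (kappa_S_shift hn k0) (kappa_S_shift_deriv hn k0)
  (size_kappa_Phi hn _) (size_kappa_Psi _ _) orthP) => k.
  exact: kappa_moment_shift.
by rewrite /jacobi_momentC complex_real.
Qed.

End KappaFamily.

Theorem mainTheorem6 (R : realType) (n : nat) (kappa : R)
    (hn : (3 <= n)%N) (hkappa : 0 <= kappa) :
  classical_pair (Wkappa n kappa) (Dkappa n kappa) /\
  (forall P : nat -> {poly 'M[R[i]]_2},
     mvop (Wkappa n kappa) P ->
     mvop (Wkappa n (kappa + 1)) (fun d : nat => deriv (P d.+1))).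
Proof.
split; first exact: kappa_classical_pair.
by move=> P; exact: mvop_deriv.
Qed.
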